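(* Every non-degenerate self-similar set on $\mathbb{R}^d$ generated by a rotation-free iterated function system is Newhouse projectively thick.
   Context: Let $\phi_i:\mathbb{R}^d\to\mathbb{R}^d$, $i=1,\dots,N$, be finitely many contractive similarity maps $\phi_i(x)=\rho_iO_ix+b_i$, where $0<\rho_i<1$, $O_i$ is an orthogonal transformation and $b_i\in\mathbb{R}^d$. Then $\Phi=\{\phi_i: i=1,\dots,N\}$ is called an iterated function system (IFS), and the self-similar set generated by $\Phi$ is the unique non-empty compact set $K$ with $K=\bigcup_{i=1}^N\phi_i(K)$. The IFS is rotation-free if all $O_i$ are the identity. A self-similar set is non-degenerate if it is not contained in any hyperplane (affine subspace of dimension $d-1$) of $\mathbb{R}^d$. Newhouse thickness of Cantor sets. A Cantor set is a nonempty, totally disconnected, perfect and compact set. Let $K\subset\mathbb{R}$ be a Cantor set. A gap of $K$ is a connected component of $\mathbb{R}\setminus K$; a bounded gap is a bounded connected component of $\mathbb{R}\setminus K$. $|I|$ denotes the length of an interval $I$ (unbounded gaps have infinite length). Let $U=(u',u)$ be a bounded gap of $K$. The bridge $C$ of $K$ at $u$ is the maximal interval on the right hand side of $u$ such that $u$ is a boundary point of $C$ and $C$ contains no point of a gap $U'$ with $|U'|\ge |U|$. The bridge at $u'$ is defined analogously, as the maximal interval on the left hand side of $u'$ with the same property. For a boundary point $u$ of a bounded gap $U$ with bridge $C$ at $u$, $\tau(K,u)=|C|/|U|$, and $\tau(K)=\inf_{u\in\mathcal{U}}\tau(K,u)$, where $\mathcal{U}$ is the set of all boundary points of bounded gaps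 of $K$. Newhouse thickness of compact sets. For a compact set $K\subset\mathbb{R}$, a point $x\in K$ is a condensation point of $K$ if every open neighborhood of $x$ contains uncountably many points of $K$. The perfect part $P_K$ of $K$ is the set of all condensation points of $K$. Define $\tau(K)=0$ if $P_K=\emptyset$; $\tau(K)=\infty$ if $P_K$ contains an interval (of positive length); and $\tau(K)=\tau(P_K)$ otherwise (in which case $P_K$ is a Cantor set). A compact set $E\subset\mathbb{R}^d$ is Newhouse projectively thick if for all invertible linear transformations $T$ on $\mathbb{R}^d$, the orthogonal projection of $T(E)$ onto the $x_1$-axis (regarded as a compact subset of $\mathbb{R}$) has positive Newhouse thickness (the value $\infty$ being allowed). *)

(* Defs.v *)
(* MathComp / MathComp-Analysis.  Points of R^n are row vectors 'rV[R]_n, with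
   their product (= Euclidean) topology. *)
From HB Require Import structures.
From mathcomp Require Import all_boot all_order all_algebra.
From mathcomp Require Import all_classical all_reals all_analysis.
Set Implicit Arguments.
Unset Strict Implicit.
Unset Printing Implicit Defensive.
Import Order.TTheory GRing.Theory Num.Theory.
Import numFieldNormedType.Exports.
Local Open Scope classical_set_scope.
Local Open Scope ring_scope.

Record similarity (R : realType) (n : nat) := Similarity {
  sim_ratio : R;
  sim_orth : 'M[R]_n;
  sim_trans : 'rV[R]_n;
  sim_ratio_gt0 : 0 < sim_ratio;
  sim_ratio_lt1 : sim_ratio < 1;
  sim_orthP : sim_orth *m sim_orth^T = 1%:M }.

(* With row vectors the matrix acts on the right. *)
Definition sim_map (R : realType) (n : nat) (phi : similarity R n)
    (x : 'rV[R]_n) : 'rV[R]_n :=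
  sim_ratio phi *: (x *m sim_orth phi) + sim_trans phi.

Definition ifs (R : realType) (n N : nat) : Type := 'I_N -> similarity R n.

Definition rotation_free (R : realType) (n N : nat) (Phi : ifs R n N) : Prop :=
  forall i, sim_orth (Phi i) = 1%:M.

(* Hutchinson's theorem: for N > 0 exactly one K satisfies this.  For N = 0
   none does, since the union is then empty. *)
Definition self_similar_set (R : realType) (n N : nat) (Phi : ifs R n N)
    (K : set 'rV[R]_n) : Prop :=
  [/\ K !=set0, compact K & K = \bigcup_(i in [set: 'I_N]) sim_map (Phi i) @` K].

Definition hyperplane (R : realType) (n : nat) (H : set 'rV[R]_n.+1) : Prop :=
  exists (a : 'rV[R]_n.+1) (V : {vspace 'rV[R]_n.+1}),
    \dim V = n /\ H = [set a + v | v in [set v | v \in V]].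

Definition nondegenerate_set (R : realType) (n : nat) (K : set 'rV[R]_n.+1) : Prop :=
  forall H, hyperplane H -> ~ (K `<=` H).

Definition gap (R : realType) (K U : set R) : Prop :=
  exists2 x, (~` K) x & U = connected_component (~` K) x.

(* Only used for intervals I; unbounded ones have length +oo. *)
Definition len (R : realType) (I : set R) : \bar R := lebesgue_measure I.

(* The intervals among which the bridge at the endpoint u of the gap U is the
   maximal one.  S is the closed half-line from u pointing away from U. *)
Definition bridge_candidate (R : realType) (K U S : set R) (u : R) (C : set R) :
    Prop :=
  [/\ is_interval C, C `<=` S, closure C u /\ ~ interior C u
    & forall U', gap K U' -> (len U <= len U')%E -> C `&` U' = set0].

Definition bridge (R : realType) (K U S : set R) (u : R) (C : set R) : Prop :=
  bridge_candidate K U S u C /\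
  forall C', bridge_candidate K U S u C' -> C `<=` C' -> C' = C.

(* For a Cantor set K the bridge at each endpoint of a bounded gap exists and
   is unique, so the sets below range over the values tau(K, u). *)
Definition cantor_thickness (R : realType) (K : set R) : \bar R :=
  ereal_inf [set t : \bar R | exists (u' u : R) (C : set R),
    [/\ u' < u, gap K `]u', u[%classic,
        bridge K `]u', u[%classic `[u, +oo[%classic u C \/
        bridge K `]u', u[%classic `]-oo, u']%classic u' C
      & t = (len C / len `]u', u[%classic)%E]].

Definition condensation_point (R : realType) (K : set R) (x : R) : Prop :=
  K x /\ forall V : set R, open V -> V x -> ~ countable (V `&` K).

Definition perfect_part (R : realType) (K : set R) : set R :=
  [set x | condensation_point K x].

Definition newhouse_thickness (R : realType) (K : set R) : \bar R :=
  if `[< perfect_part K = set0 >] then 0%E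
  else if `[< exists a b : R, a < b /\ `[a, b]%classic `<=` perfect_part K >]
  then +oo%E
  else cantor_thickness (perfect_part K).

Definition proj1_axis (R : realType) (n : nat) (x : 'rV[R]_n.+1) : R :=
  x ord0 ord0.

Definition newhouse_projectively_thick (R : realType) (n : nat)
    (E : set 'rV[R]_n.+1) : Prop :=
  compact E /\
  forall T : {linear 'rV[R]_n.+1 -> 'rV[R]_n.+1}, bijective T ->
    (0 < newhouse_thickness (@proj1_axis R n @` (T @` E)))%E.

(* Main.v *)
Require Import Defs.
From HB Require Import structures.
From mathcomp Require Import all_boot all_order all_algebra.
From mathcomp Require Import all_classical all_reals all_analysis.
From mathcomp Require Import ring lra.
Local Open Scope classical_set_scope.
Local Open Scope ring_scope.
Import Order.TTheory GRing.Theory Num.Theory.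
Import numFieldNormedType.Exports.

(** The image E of K under x |-> (T x)_1 is again self-similar, now on the line:
a linear functional turns a homothety of ratio rho into an affine map of ratio
rho.  Non-degeneracy says exactly that E is not a single point, since a level
set of a nonzero functional is a hyperplane.  So let E be compact, with extreme
points a < b, and the union of affine images of itself with ratios in ]0, 1[;
let m be the smallest ratio.

Subdividing a copy of E multiplies its size by at least m, so every point x of E
lies, for each scale 0 < e <= b - a, in a copy r E + c contained in E whose
diameter r (b - a) is in [m e, e[ (self_affine_fine_copies).  Everything else
uses only this.

Copies at scale (b - a) / 2 around a and around b are disjoint, so each copy of
E contains two disjoint ones and a Cantor-scheme argument makes each copy
uncountable (splitting_uncountable).  Small copies around x being uncountable,
every point of E is a condensation point and E is its own perfect part
(perfect_part_fine_copies).

For the thickness, let ]u', u[ be a bounded gap; its endpoints are in E.  Take a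
copy around u at scale e = u - u'.  It is too short to jump across the gap, so
it lies to the right of u, starts at u, and its hull is [u, t] with t in E and
t - u in [m (u - u'), u - u'[.  A gap meeting this hull is trapped inside it, as
both ends of the hull are in E, hence is shorter than ]u', u[.  The hull is
therefore contained in the bridge at u (bridge_contains), whose length is at
least m (u - u').  The endpoint u' is symmetric, and the thickness of E is at
least m > 0 (cantor_thickness_ge). *)

(** * Uncountability by repeated splitting *)

(** Cantor's diagonal argument along a tree: if f numbers the points of A, go
down from A through nested members of P, choosing at step n a half that misses
the point numbered n.  By compactness some point survives, and it has no
number. *)
Lemma splitting_uncountable {T : topologicalType} (P : set (set T)) :
  hausdorff_space T ->
  (forall A, P A -> compact A /\ A !=set0) ->
  (forall A, P A -> exists B C,
    [/\ P B, P C, B `<=` A, C `<=` A & B `&` C = set0]) ->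
  forall A, P A -> ~ countable A.
Proof.
move=> hT Pcpt Psplit A PA /countable_injP[f finj].
(* The step is stated for all pairs (B, n) so that a choice function can drive
   the recursion; the hypothesis P B moves inside the existential. *)
have avoid (Bn : set T * nat) : exists C : set T, P Bn.1 ->
    [/\ P C, C `<=` Bn.1 & Bn.1 `<=` A -> forall x, C x -> f x <> Bn.2].
  case: Bn => B n /=; have [PB|nPB] := pselect (P B); last by exists set0.
  have [C [D [PC PD CB DB CD0]]] := Psplit B PB.
  (* If C contains a point numbered n, then D does not: f is injective on A. *)
  have [[x Cx fxn]|nC] := pselect (exists2 x, C x & f x = n); last first.
    by exists C => _; split => // _ x Cx fxn; apply: nC; exists x.
  exists D => _; split => // BA y Dy fyn.
  have xy : x = y.
    by apply: finj; rewrite ?inE ?fxn ?fyn//; apply: BA; [exact: CB|exact: DB].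
  have : (C `&` D) x by split; rewrite // xy.
  by rewrite CD0.
have [g gP] := choice avoid.
pose F := fix F n := if n is m.+1 then g (F m, m) else A.
have PF n : P (F n) by elim: n => //= n IH; have [] := gP (F n, n) IH.
have FS n : F n.+1 `<=` F n by have [] := gP (F n, n) (PF n).
have Fmono m n : (m <= n)%N -> F n `<=` F m.
  elim: n => [|n IH]; first by rewrite leqn0 => /eqP->.
  rewrite leq_eqVlt => /predU1P[->//|]; rewrite ltnS => /IH.
  exact: subset_trans (FS n).
have [x xF] := choice (fun n => (Pcpt _ (PF n)).2).
have Fev n : \forall k \near \oo, F n (x k).
  by exists n => // k /= nk; exact: Fmono (xF k).
have [y [Ay yx]] : A `&` cluster (x @ \oo) !=set0.
  have [cA _] := Pcpt _ PA.
  by apply: cA; exact: (Fev 0%N).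
have Fy n : F n y.
  have /closure_id-> : closed (F n) by apply: compact_closed => //; have [] := Pcpt _ (PF n).
  by move: yx; rewrite clusterE; apply; exact: Fev.
have [_ _ /(_ (Fmono 0%N _ isT) y (Fy (f y).+1))] := gP (F (f y), f y) (PF (f y)).
by [].
Qed.

(** * Affine copies of a self-similar set of the line *)

Definition affine_copy {R : realType} (E : set R) (r c : R) : set R :=
  (fun x => r * x + c) @` E.

(** With D the diameter of E, r * D is the diameter of the copy: each point of E
lies in copies contained in E at every scale e, with sizes controlled from below
by m. *)
Definition fine_copies {R : realType} (E : set R) (D m : R) : Prop :=
  forall x e, E x -> 0 < e <= D -> exists r c,
    [/\ 0 < r, m * e <= r * D < e, affine_copy E r c x & affine_copy E r c `<=` E].

Lemma exprn_small {R : realType} (q e : R) :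
  0 <= q < 1 -> 0 < e -> exists n, q ^+ n < e.
Proof.
move=> /andP[q0 q1] e0.
have /cvgr0Pnorm_lt/(_ _ e0)[n _ /(_ n (leqnn n))/=] : (GRing.exp q : R ^nat) @ \oo --> 0.
  by apply: cvg_expr; rewrite ger0_norm.
by rewrite ger0_norm ?exprn_ge0//; exists n.
Qed.

(** Start from E itself and pass to the sub-copy containing x until the size
drops below e.  The last step loses at most the factor m, the smallest ratio,
and the process stops because all ratios are at most some q < 1. *)
Lemma self_affine_fine_copies {R : realType} {N : nat} {E : set R}
    {rho c : 'I_N -> R} (D : R) :
  (forall i, 0 < rho i < 1) ->
  E = \bigcup_(i in [set: 'I_N]) affine_copy E (rho i) (c i) ->
  exists2 m, 0 < m & fine_copies E D m.
Proof.
move=> rho01 Eself.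
pose m := \big[Order.min/1]_i rho i; pose q := \big[Order.max/0]_i rho i.
have m0 : 0 < m by apply: lt_bigmin => // i _; case/andP: (rho01 i).
have mle i : m <= rho i by exact: bigmin_le.
have q0 : 0 <= q by exact: bigmax_ge_id.
have q1 : q < 1 by apply: bigmax_lt => // i _; case/andP: (rho01 i).
have qge i : rho i <= q by exact: le_bigmax.
exists m => // x e Ex /andP[e0 eD].
have D0 : 0 < D by lra.
(* After n subdivisions the process has either stopped or r is at most
   q ^+ n; large n excludes the second case. *)
suff copy n : exists r c, [/\ 0 < r, m * e <= r * D,
    r * D < e \/ r <= q ^+ n, affine_copy E r c x & affine_copy E r c `<=` E].
  have [n qn] : exists n, q ^+ n < e / D.
    by apply: exprn_small; [rewrite q0 q1|rewrite divr_gt0].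
  have [r [b [r0 mer small rx rE]]] := copy n.
  exists r, b; split => //; rewrite mer /=.
  case: small => // rq.
  by rewrite -ltr_pdivlMr//; exact: le_lt_trans qn.
elim: n => [|n [r [b [r0 mer small [y Ey yx] rE]]]].
  exists 1, 0; split => //.
  - have m1 : m <= 1 by exact: bigmin_le_id.
    by rewrite mul1r (le_trans _ eD)// ler_piMl// ltW.
  - by right; rewrite expr0.
  - by exists x => //; ring.
  - by move=> _ [z Ez <-]; rewrite mul1r addr0.
have [rDe|erD] := ltP (r * D) e.
  by exists r, b; split => //; [left|exists y].
have rq : r <= q ^+ n by case: small => //; rewrite ltNge erD.
have := Ey; rewrite {1}Eself => -[i _ [z Ez zy]].
have /andP[i0 i1] := rho01 i.
exists (r * rho i), (r * c i + b); split.
- exact: mulr_gt0.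
- rewrite mulrAC [leRHS]mulrC; apply: ler_pM => //; exact: ltW.
- right; rewrite exprSr; apply: ler_pM => //; exact: ltW.
- by exists z => //; rewrite -yx -zy; ring.
- move=> _ [w Ew <-]; apply: rE; exists (rho i * w + c i); last by ring.
  by rewrite Eself; exists i => //; exists w.
Qed.

Lemma affine_copy_hull {R : realType} {E : set R} {a b r c : R} :
  (forall x, E x -> a <= x <= b) -> 0 < r ->
  forall x, affine_copy E r c x -> r * a + c <= x <= r * b + c.
Proof.
move=> Eab r0 _ [x Ex <-]; have /andP[ax xb] := Eab x Ex.
by rewrite !lerD2r !ler_pM2l// ax xb.
Qed.

Lemma compact_affine_copy {R : realType} (E : set R) (r c : R) :
  compact E -> compact (affine_copy E r c).
Proof.
move=> cE; apply: continuous_compact => //; apply: continuous_subspaceT => x.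
by apply: cvgD; [apply: cvgM; [exact: cvg_cst|exact: cvg_id]|exact: cvg_cst].
Qed.

(** E contains two disjoint copies of itself, one near each of its extreme
points, so all copies of E split and are uncountable; arbitrarily small copies
surround every point of E. *)
Lemma perfect_part_fine_copies {R : realType} {E : set R} {a b m : R} :
  compact E -> a < b -> E a -> E b -> (forall x, E x -> a <= x <= b) ->
  fine_copies E (b - a) m -> perfect_part E = E.
Proof.
move=> cE ab Ea Eb Eab fE.
have copy_uncountable r c : 0 < r -> ~ countable (affine_copy E r c).
  move=> r0; apply: (splitting_uncountable
    [set A | exists r c, 0 < r /\ A = affine_copy E r c]); last by exists r, c.
  - exact: Rhausdorff.
  - move=> _ [s [e [s0 ->]]]; split; first exact: compact_affine_copy.
    by exists (s * a + e), a.
  move=> _ [s [e [s0 ->]]].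
  have e2 : 0 < (b - a) / 2 <= b - a by apply/andP; split; lra.
  have [r1 [c1 [r10 /andP[_ d1] a1 E1]]] := fE a _ Ea e2.
  have [r2 [c2 [r20 /andP[_ d2] b2 E2]]] := fE b _ Eb e2.
  have nest t f : affine_copy E t f `<=` E ->
      affine_copy E (s * t) (s * f + e) `<=` affine_copy E s e.
    move=> tE _ [x Ex <-]; exists (t * x + f); last by ring.
    by apply: tE; exists x.
  exists (affine_copy E (s * r1) (s * c1 + e)), (affine_copy E (s * r2) (s * c2 + e)).
  split; [|  | exact: nest | exact: nest | ].
  - by exists (s * r1), (s * c1 + e); split => //; exact: mulr_gt0.
  - by exists (s * r2), (s * c2 + e); split => //; exact: mulr_gt0.
  (* Both copies are shorter than (b - a) / 2; one contains a, the other b. *)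
  rewrite -subset0 => z [[x Ex <-] [y Ey]].
  move=> /eqP; rewrite -!mulrA !addrA -!mulrDr (inj_eq (addIr _)).
  rewrite (inj_eq (mulfI (lt0r_neq0 s0))) => /eqP yx.
  have := affine_copy_hull Eab r10 a a1; have := affine_copy_hull Eab r20 b b2.
  have : affine_copy E r1 c1 (r1 * x + c1) by exists x.
  move=> /(affine_copy_hull Eab r10).
  have : affine_copy E r2 c2 (r2 * y + c2) by exists y.
  move=> /(affine_copy_hull Eab r20).
  rewrite yx; nra.
apply/seteqP; split => [x []//|x Ex]; split => // V oV Vx VE.
have /nbhs_ballP[e /= e0 eV] : nbhs x V by exact: open_nbhs_nbhs.
have e1 : 0 < Num.min e (b - a) <= b - a.
  by rewrite ge_min lexx orbT lt_min e0 subr_gt0 ab.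
have [r [c [r0 /andP[_ rD] rx rE]]] := fE x _ Ex e1.
apply: (copy_uncountable r c r0); apply: sub_countable VE; apply: subset_card_le.
move=> y ry; split; last exact: rE.
apply: eV; rewrite /ball /= ltr_norml.
have := affine_copy_hull Eab r0 x rx; have := affine_copy_hull Eab r0 y ry.
have : Num.min e (b - a) <= e by rewrite ge_min lexx.
by move=> *; apply/andP; split; nra.
Qed.

(** * Gaps and bridges *)

Lemma is_intervalU1_closure {R : realType} {C : set R} {p : R} :
  is_interval C -> closure C p -> is_interval (p |` C).
Proof.
move=> iC Cp x y; rewrite /setU/=; have near z : z != p ->
    exists2 w, C w & (z < p -> z < w) /\ (p < z -> w < z).
  move=> zp; have e0 : 0 < `|z - p| by rewrite normr_gt0 subr_eq0.
  have [w [Cw]] := Cp _ (nbhsx_ballx p _ e0).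
  rewrite /ball/= => wp; exists w => //; split => [lt|lt]; move: wp.
    by rewrite (ltr0_norm (x := z - p)) ?subr_lt0// ltr_norml; lra.
  by rewrite (gtr0_norm (x := z - p)) ?subr_gt0// ltr_norml; lra.
move=> Cx Cy z /andP[xz zy]; have [->|zp] := eqVneq z p; first by left.
have [w Cw [wl wr]] := near z zp; right.
case: Cx xz => [-> pz|Cx xz]; case: Cy zy => [-> zp'|Cy zy'].
- by move: zp; rewrite eq_le zp' pz.
- by apply: (iC w y) => //; rewrite zy' ltW// wr// lt_neqAle eq_sym zp pz.
- by apply: (iC x w) => //; rewrite xz ltW// wl// lt_neqAle zp zp'.
- by apply: (iC x y) => //; rewrite xz zy'.
Qed.

Lemma gap_interval {R : realType} {E U : set R} : gap E U -> is_interval U.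
Proof. by move=> [x _ ->]; apply/connected_intervalP; exact: component_connected. Qed.

Lemma gap_disjoint {R : realType} {E U : set R} : gap E U -> U `<=` ~` E.
Proof. by move=> [x _ ->]; exact: connected_component_sub. Qed.

Lemma gap_maximal {R : realType} {E U V : set R} :
  gap E U -> V `<=` ~` E -> is_interval V -> U `&` V !=set0 -> V `<=` U.
Proof.
move=> [x Ex ->] VE iV [y [Uy Vy]]; rewrite (same_connected_component Uy).
by apply: connected_component_max => //; apply/connected_intervalP.
Qed.

(** An endpoint outside E could be added to the gap, which is a maximal interval
of the complement. *)
Lemma gap_endpoints {R : realType} {E : set R} {u' u : R} :
  u' < u -> gap E `]u', u[ -> E u' /\ E u.
Proof.
move=> u'u gU; have UE := gap_disjoint gU.
have [lm mu] : u' < (u' + u) / 2 /\ (u' + u) / 2 < u by split; lra.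
split; apply: contrapT => nE.
- have : `[u', u[ `<=` `]u', u[%classic.
    apply: (gap_maximal gU).
    + move=> z /=; rewrite in_itv/= => /andP[].
      rewrite le_eqVlt => /predU1P[<- //|lz zu]; apply: UE.
      by rewrite /= in_itv/= lz zu.
    + exact: interval_is_interval.
    + by exists ((u' + u) / 2); split; rewrite /= in_itv/= ?lm ?ltW.
  by move=> /(_ u'); rewrite /= !in_itv/= lexx u'u ltxx => /(_ isT).
- have : `]u', u] `<=` `]u', u[%classic.
    apply: (gap_maximal gU).
    + move=> z /=; rewrite in_itv/= => /andP[lz].
      rewrite le_eqVlt => /predU1P[-> //|zu]; apply: UE.
      by rewrite /= in_itv/= lz zu.
    + exact: interval_is_interval.
    + by exists ((u' + u) / 2); split; rewrite /= in_itv/= ?lm ?ltW.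
  by move=> /(_ u); rewrite /= !in_itv/= lexx u'u ltxx andbF => /(_ isT).
Qed.

(** A gap meeting [s, t] cannot contain s or t, so it is contained in [s, t] and
is shorter than U.  Adding [s, t] to the bridge C therefore gives another
candidate, and C is the maximal one. *)
Lemma bridge_contains {R : realType} {E U S C : set R} {p s t : R} :
  bridge E U S p C -> E s -> E t -> s < t -> ((t - s)%:E < len U)%E ->
  s <= p <= t -> `[s, t] `<=` S -> ~ interior S p -> `[s, t] `<=` C.
Proof.
move=> [[iC CS [Cp _] Cgap] Cmax] Es Et st stU pst IS Sp.
(* C need not contain p; adding p gives two connected sets sharing a point. *)
have CI : C `|` `[s, t]%classic = (p |` C) `|` `[s, t]%classic.
  apply/seteqP; split => x [Cx|Ix]; [by left; right|by right| |by right].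
  by case: Cx => [->|Cx]; [right; rewrite /= in_itv|left].
have <- : C `|` `[s, t]%classic = C; last by move=> x; right.
apply: Cmax; last by move=> x; left.
split.
- rewrite CI; apply/connected_intervalP; apply: connectedU.
  + by exists p; split; [left|rewrite /= in_itv].
  + by apply/connected_intervalP; exact: is_intervalU1_closure.
  + exact: segment_connected.
- by move=> x [/CS//|/IS].
- split; first by apply: subset_closure; right; rewrite /= in_itv.
  by apply: contra_not Sp; rewrite /interior; apply: filterS => x [/CS//|/IS].
move=> V gV UV; rewrite setIUl Cgap// set0U -subset0 => z [].
rewrite /= in_itv/= => /andP[sz zt] Vz.
have Vst : V `<=` `[s, t]%classic.
  move=> y Vy; rewrite /= in_itv/=; apply/andP; split; rewrite leNgt; apply/negP => yst.
    suff /(gap_disjoint gV) : V s by [].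
    by apply: (gap_interval gV _ _ Vy Vz); rewrite sz ltW.
  suff /(gap_disjoint gV) : V t by [].
  by apply: (gap_interval gV _ _ Vz Vy); rewrite zt ltW.
have := lt_le_trans stU UV; rewrite ltNge => /negP; apply.
rewrite /len; apply: (@le_trans _ _ (lebesgue_measure (`[s, t]%classic : set R))).
  apply: le_measure => //; rewrite inE//.
  by apply: measurable_realfun.is_interval_measurable; exact: gap_interval gV.
by rewrite lebesgue_measure_itv/= lte_fin st EFinB.
Qed.

(** The copy of E around an endpoint of a gap, at the scale of the gap, is a part
of the bridge there. *)
Lemma cantor_thickness_ge {R : realType} {E : set R} {a b m : R} :
  0 < m -> a < b -> E a -> E b -> (forall x, E x -> a <= x <= b) ->
  fine_copies E (b - a) m -> (m%:E <= cantor_thickness E)%E.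
Proof.
move=> m0 ab Ea Eb Eab fE; apply: le_ereal_inf_tmp => _ [u' [u [C [u'u gU bC ->]]]].
have [Eu' Eu] := gap_endpoints u'u gU; have UE := gap_disjoint gU.
have lenU : len `]u', u[%classic = (u - u')%:E.
  by rewrite /len lebesgue_measure_itv/= lte_fin u'u EFinB.
have uu' : 0 < u - u' <= b - a.
  by have := Eab _ Eu; have := Eab _ Eu'; rewrite subr_gt0 u'u => *; lra.
have outside z : E z -> z <= u' \/ u <= z.
  move=> Ez; have [|u'z] := leP z u'; [by left|right]; rewrite leNgt; apply/negP => zu.
  by apply: (UE z) => //; rewrite /= in_itv/= u'z.
rewrite lenU inver gt_eqF ?subr_gt0// lee_pdivlMr ?subr_gt0// -EFinM.
suff [s [t [st sC]]] : exists s t, m * (u - u') <= t - s /\ `[s, t] `<=` C.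
  apply: (@le_trans _ _ (lebesgue_measure (`[s, t]%classic : set R))).
    have lt_st : s < t by rewrite -subr_gt0; apply: lt_le_trans st; rewrite mulr_gt0// subr_gt0.
    by rewrite lebesgue_measure_itv/= lte_fin lt_st -EFinB lee_fin.
  apply: le_measure => //; rewrite inE//; apply: measurable_realfun.is_interval_measurable.
  by case: bC => -[[]].
(* The numbers s and t are the extreme points of the copy around p. *)
have hull p : E p -> exists s t, [/\ E s, E t, s < t, s <= p <= t &
    m * (u - u') <= t - s < u - u'].
  move=> Ep; have [r [c [r0 size rp rE]]] := fE p _ Ep uu'.
  exists (r * a + c), (r * b + c); split.
  - by apply: rE; exists a.
  - by apply: rE; exists b.
  - by rewrite ltrD2r ltr_pM2l.
  - exact: affine_copy_hull rp.
  - by move: size; rewrite mulrBr; lra.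
case: bC => bC.
(* The copy is shorter than the gap, so its left end s, a point of E, is beyond
   u', hence s = u. *)
- have [s [t [Es Et st /andP[su ut] /andP[mst stU]]]] := hull _ Eu.
  have us : u <= s by case: (outside _ Es) => // su'; exfalso; lra.
  exists s, t; split => //; apply: (bridge_contains bC) => //.
  + by rewrite lenU lte_fin.
  + by rewrite su ut.
  + by move=> z; rewrite /= !in_itv/= andbT => /andP[+ _]; exact: le_trans.
  + by rewrite interior_itv_bndy /= in_itv/= ltxx.
- have [s [t [Es Et st /andP[su ut] /andP[mst stU]]]] := hull _ Eu'.
  have tu' : t <= u' by case: (outside _ Et) => // tu; exfalso; lra.
  exists s, t; split => //; apply: (bridge_contains bC) => //.
  + by rewrite lenU lte_fin.
  + by rewrite su ut.
  + by move=> z; rewrite /= !in_itv/= => /andP[_ zt]; exact: le_trans tu'.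
  + by rewrite interior_itv_Nybnd /= in_itv/= ltxx.
Qed.

(** The second hypothesis excludes a one-point E, whose perfect part is empty. *)
Lemma newhouse_thickness_self_affine_gt0 {R : realType} {N : nat} (E : set R)
    (rho c : 'I_N -> R) :
  compact E -> (exists x y, [/\ E x, E y & x != y]) ->
  (forall i, 0 < rho i < 1) ->
  E = \bigcup_(i in [set: 'I_N]) affine_copy E (rho i) (c i) ->
  (0 < newhouse_thickness E)%E.
Proof.
move=> cE [x [y [Ex Ey xy]]] rho01 Eself.
have idE : {within E, continuous (@id R)} by apply: continuous_subspaceT => z.
have E0 : E !=set0 by exists x.
have [a /set_mem Ea amin] := compact_EVT_min E0 cE idE.
have [b /set_mem Eb bmax] := compact_EVT_max E0 cE idE.
have Eab z : E z -> a <= z <= b by move=> /mem_set Ez; rewrite amin// bmax.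
have ab : a < b.
  by move: (Eab x Ex) (Eab y Ey) xy; rewrite neq_lt => ? ? /orP[] ?; lra.
have [m m0 fE] := self_affine_fine_copies (b - a) rho01 Eself.
rewrite /newhouse_thickness (perfect_part_fine_copies cE ab Ea Eb Eab fE).
case: asboolP => [E00|_]; first by move: Ex; rewrite E00.
case: asboolP => _; first exact: ltry.
by apply: lt_le_trans (cantor_thickness_ge m0 ab Ea Eb Eab fE); rewrite lte_fin.
Qed.

(** * Linear functionals *)

Lemma linear_functional_continuous {R : realType} {n : nat}
    (f : {linear 'rV[R]_n.+1 -> R^o}) : continuous (f : 'rV[R]_n.+1 -> R).
Proof.
have -> : (f : 'rV[R]_n.+1 -> R) = (fun x => \sum_j x ord0 j * f (delta_mx 0 j)).
  apply/funext => x; rewrite {1}(row_sum_delta x) linear_sum.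
  by apply: eq_bigr => j _; rewrite linearZ.
move=> x; apply: (cvg_big add_continuous) => [|j _]; first exact: (nbhs_filter x).
apply: cvgM; [exact: (nbhs_filter x)|exact: coord_continuous|].
by apply: cvg_cst; exact: (nbhs_filter x).
Qed.

(** The level set through a is a translate of the kernel, which has codimension
1 by the rank-nullity theorem. *)
Lemma linear_functional_level_hyperplane {R : realType} {n : nat}
    (f : {linear 'rV[R]_n.+1 -> R^o}) (a : 'rV[R]_n.+1) {v : 'rV[R]_n.+1} :
  f v != 0 -> hyperplane [set x | f x = f a].
Proof.
move=> fv; exists a, (lker (linfun f)); split.
  have := limg_ker_dim (linfun f) fullv.
  rewrite capfv dimvf /dim/= mul1n.
  have -> : \dim (linfun f @: fullv) = 1%N.
    apply/eqP; rewrite eqn_leq; apply/andP; split.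
      by rewrite (leq_trans (dimvS (subvf _)))// dimvf.
    rewrite lt0n dimv_eq0; apply: contra fv => /eqP img0.
    have := memv_img (linfun f) (memvf v); rewrite img0 memv0 lfunE/=.
    by [].
  by rewrite addn1 => -[].
apply/seteqP; split => [x /= fx|_ [w /= + <-]].
  exists (x - a); last by rewrite addrC subrK.
  by rewrite /= memv_ker lfunE/= linearB/= fx subrr.
by rewrite memv_ker lfunE/= => /eqP fw; rewrite linearD/= fw addr0.
Qed.

Theorem mainTheorem4 (R : realType) (d N : nat) (Phi : ifs R d.+1 N)
    (K : set 'rV[R]_d.+1) :
  rotation_free Phi -> self_similar_set Phi K -> nondegenerate_set K ->
  newhouse_projectively_thick K.
Proof.
move=> rf [K0 cK Kself] nd; split => // T [T' TK' T'K].
pose L x : R^o := proj1_axis (T x).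
have Llin : linear L.
  by move=> k x y; rewrite /L /proj1_axis linearP/= !mxE.
pose HL := GRing.isLinear.Build _ _ _ _ L Llin.
pose f : {linear 'rV[R]_d.+1 -> R^o} := HB.pack L HL.
have fL x : f x = L x by [].
have Lcont : continuous (L : _ -> R) := linear_functional_continuous f.
rewrite image_comp -/L.
apply: (@newhouse_thickness_self_affine_gt0 _ N _ (fun i => sim_ratio (Phi i))
  (fun i => L (sim_trans (Phi i)))).
- by apply: continuous_compact => //; exact: continuous_subspaceT.
- have [a Ka] := K0.
  (* T' (const_mx 1) witnesses that the first coordinate of T is nonzero. *)
  have fv : f (T' (const_mx 1)) != 0.
    by rewrite fL /L T'K /proj1_axis mxE oner_eq0.
  have /existsNP[x] := nd _ (linear_functional_level_hyperplane f a fv).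
  move=> /not_implyP[Kx fxa]; exists (L x), (L a); split.
  + by exists x.
  + by exists a.
  + exact/eqP.
- by move=> i; rewrite sim_ratio_gt0 sim_ratio_lt1.
have Lsim i x : L (sim_map (Phi i) x) = sim_ratio (Phi i) * L x + L (sim_trans (Phi i)).
  by rewrite /sim_map rf mulmx1 -!fL linearD linearZ.
apply/seteqP; split => [_ [x Kx <-]|_ [i _ [_ [x Kx <-] <-]]].
  move: Kx; rewrite {1}Kself => -[i _ [y Ky <-]].
  by exists i => //; exists (L y); [exists y|rewrite -Lsim].
exists (sim_map (Phi i) x); last by rewrite -Lsim.
by rewrite Kself; exists i => //; exists x.
Qed.
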